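(* Let $(\mathcal{C},\mathbb{E},\mathfrak{s})$ be a Krull–Schmidt extriangulated category, and let $\mathcal{X},\mathcal{Y}$ be subcategories of $\mathcal{C}$. If $([\mathcal{X}],[\mathcal{Y}])$ is a complete ideal cotorsion pair in $\mathcal{C}$, then $(\mathcal{X},\mathcal{Y})$ is a complete cotorsion pair in $\mathcal{C}$.
   Context: **Extriangulated categories.** $(\mathcal{C},\mathbb{E},\mathfrak{s})$ is an extriangulated category in the sense of Nakaoka–Palu: $\mathcal{C}$ is an additive category, $\mathbb{E}\colon\mathcal{C}^{\mathrm{op}}\times\mathcal{C}\to\mathrm{Ab}$ is an additive bifunctor, and $\mathfrak{s}$ is an additive realization assigning to each $\delta\in\mathbb{E}(C,A)$ an equivalence class of sequences $A\to B\to C$, subject to axioms (ET3), (ET3)$^{\mathrm{op}}$, (ET4), (ET4)$^{\mathrm{op}}$. If $A\xrightarrow{x}B\xrightarrow{y}C$ realizes $\delta$, one writes $A\xrightarrow{x}B\xrightarrow{y}C\overset{\delta}{\dashrightarrow}$ and calls it an $\mathbb{E}$-triangle; $x$ is then an inflation and $y$ a deflation. For $a\colon A\to A'$ and $c\colon C'\to C$ put $a_*\delta=\mathbb{E}(C,a)(\delta)$ and $c^*\delta=\mathbb{E}(c,A)(\delta)$. For morphisms $i\colon A\to B$, $j\colon X\to Y$, $\mathbb{E}(i,j)\colon\mathbb{E}(B,X)\to\mathbb{E}(A,Y)$ is $\delta\mapsto j_*i^*\delta$. It is Krull–Schmidt if the underlying additive category is: every object decomposes as a finite direct sum of indecomposable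 objects with local endomorphism rings (uniquely up to isomorphism and permutation of summands). **Complete cotorsion pairs.** A pair $(\mathcal{X},\mathcal{Y})$ of subcategories of $\mathcal{C}$ is a complete cotorsion pair if $\mathcal{X}$ and $\mathcal{Y}$ are closed under isomorphisms and direct summands and: (1) $\mathbb{E}(X,Y)=0$ for all $X\in\mathcal{X}$, $Y\in\mathcal{Y}$; (2) every $C\in\mathcal{C}$ admits an $\mathbb{E}$-triangle $Y^C\to X^C\to C\dashrightarrow$ with $X^C\in\mathcal{X}$, $Y^C\in\mathcal{Y}$; (3) every $C\in\mathcal{C}$ admits an $\mathbb{E}$-triangle $C\to Y_C\to X_C\dashrightarrow$ with $X_C\in\mathcal{X}$, $Y_C\in\mathcal{Y}$. **Ideals.** An ideal $\mathcal{I}$ of $\mathcal{C}$ is a collection of subgroups $\mathcal{I}(X,Y)\subseteq\mathrm{Hom}_{\mathcal{C}}(X,Y)$ closed under composition with arbitrary morphisms on both sides. For a subcategory $\mathcal{D}$, $[\mathcal{D}]$ is the class of all morphisms of $\mathcal{C}$ that factor through some object of $\mathcal{D}$. For an ideal $\mathcal{S}$, ${}^{\perp_1}\mathcal{S}=\{f\mid\mathbb{E}(f,s)=0\ \forall s\in\mathcal{S}\}$ and $\mathcal{S}^{\perp_1}=\{g\mid\mathbb{E}(s,g)=0\ \forall s\in\mathcal{S}\}$. **Complete ideal cotorsion pairs.** A special $\mathcal{I}$-precover of $M$ is a deflation $f\colon X\to M$ in $\mathcal{I}$ for which there are an $\mathbb{E}$-triangle $A\to B\to M\overset{\lambda}{\dashrightarrow}$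 and a morphism $h\colon A\to K$ in $\mathcal{I}^{\perp_1}$ such that $f$ is the deflation of an $\mathbb{E}$-triangle $K\to X\xrightarrow{f}M\overset{h_*\lambda}{\dashrightarrow}$ (with a morphism of $\mathbb{E}$-triangles from the former to the latter given by $h$ on the left and $1_M$ on the right). Dually, a special $\mathcal{J}$-preenvelope of $M$ is an inflation $g\colon M\to Y$ in $\mathcal{J}$ for which there are an $\mathbb{E}$-triangle $M\to A\to B\overset{\delta}{\dashrightarrow}$ and a morphism $h\colon C\to B$ in ${}^{\perp_1}\mathcal{J}$ such that $g$ is the inflation of an $\mathbb{E}$-triangle $M\xrightarrow{g}Y\to C\overset{h^*\delta}{\dashrightarrow}$ (with a morphism of $\mathbb{E}$-triangles from the latter to the former given by $1_M$ on the left and $h$ on the right). The ideal $\mathcal{I}$ is special precovering (resp. $\mathcal{J}$ is special preenveloping) if every object has a special $\mathcal{I}$-precover (resp. special $\mathcal{J}$-preenvelope). A pair of ideals $(\mathcal{I},\mathcal{J})$ is an ideal cotorsion pair if $\mathcal{I}^{\perp_1}=\mathcal{J}$ and $\mathcal{I}={}^{\perp_1}\mathcal{J}$; it is complete if moreover $\mathcal{I}$ is special precovering and $\mathcal{J}$ is special preenveloping.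
   Formalization: The subcategories X and Y are assumed closed under isomorphisms and direct summands; without this the claim fails, e.g. finite-dimensional vector spaces with E = 0, X the even-dimensional spaces, Y everything. *)

(* Defs.v *)
From mathcomp Require Import all_boot all_algebra.

Set Implicit Arguments.
Unset Strict Implicit.
Unset Printing Implicit Defensive.

Import GRing.Theory.

Local Open Scope ring_scope.

(* Classical mathematics: the choice structure contained in a [zmodType] is    *)
(* no restriction on the abelian groups of morphisms and of extensions.        *)
Record preAddCat := PreAddCat {
  obj :> Type;
  hom : obj -> obj -> zmodType;
  idm : forall A, hom A A;
  comp : forall A B C, hom B C -> hom A B -> hom A C;
  comp1m : forall A B (f : hom A B), comp (idm B) f = f;
  compm1 : forall A B (f : hom A B), comp f (idm A) = f;
  compA : forall A B C D (h : hom C D) (g : hom B C) (f : hom A B),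
    comp h (comp g f) = comp (comp h g) f;
  compDl : forall A B C (g g' : hom B C) (f : hom A B),
    comp (g + g') f = comp g f + comp g' f;
  compDr : forall A B C (g : hom B C) (f f' : hom A B),
    comp g (f + f') = comp g f + comp g f'
}.

Arguments hom {p} A B.
Arguments idm {p} A.

Notation "g \oc f" := (comp g f) (at level 40, left associativity).

Section Category.
Variable C : preAddCat.
Implicit Types A B D : C.

Definition is_iso A B (f : hom A B) : Prop :=
  exists g : hom B A, g \oc f = idm A /\ f \oc g = idm B.

Definition isomorphic A B : Prop := exists f : hom A B, is_iso f.

Definition is_zero A : Prop :=
  forall B (f : hom A B) (g : hom B A), f = 0 /\ g = 0.

Record biprod A B := Biprod {
  bp :> obj C;
  in1 : hom A bp;
  in2 : hom B bp;
  pr1 : hom bp A;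
  pr2 : hom bp B;
  pr1_in1 : pr1 \oc in1 = idm A;
  pr2_in2 : pr2 \oc in2 = idm B;
  pr1_in2 : pr1 \oc in2 = 0;
  pr2_in1 : pr2 \oc in1 = 0;
  in_pr : in1 \oc pr1 + in2 \oc pr2 = idm bp
}.

Record fam_biprod (n : nat) (s : 'I_n -> C) := FamBiprod {
  fbp :> obj C;
  fin : forall i, hom (s i) fbp;
  fpr : forall i, hom fbp (s i);
  fpr_fin : forall i, fpr i \oc fin i = idm (s i);
  fpr_fin0 : forall i j, i != j -> fpr j \oc fin i = 0;
  fin_fpr : \sum_(i < n) fin i \oc fpr i = idm fbp
}.

Definition is_additive : Prop :=
  (exists Z, is_zero Z) /\ (forall A B, inhabited (biprod A B)).

Definition direct_summand D A : Prop :=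
  exists D' (P : biprod D D'), isomorphic P A.

Definition indecomposable A : Prop :=
  ~ is_zero A /\
  forall B D (P : biprod B D), isomorphic P A -> is_zero B \/ is_zero D.

(* The units of the ring [hom A A] are the isomorphisms; a ring is local when  *)
(* it is nonzero and its non-units are closed under addition.                  *)
Definition local_end A : Prop :=
  idm A <> 0 /\
  forall f g : hom A A, is_iso (f + g) -> is_iso f \/ is_iso g.

Definition ks_decomposition A (n : nat) (s : 'I_n -> C) : Prop :=
  (forall i, indecomposable (s i) /\ local_end (s i)) /\
  exists S : fam_biprod s, isomorphic S A.

Definition krull_schmidt : Prop :=
  (forall A, exists n (s : 'I_n -> C), ks_decomposition A s) /\
  (forall A m (s : 'I_m -> C) n (t : 'I_n -> C),
     ks_decomposition A s -> ks_decomposition A t ->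
     exists sigma : 'I_m -> 'I_n,
       bijective sigma /\ forall i, isomorphic (s i) (t (sigma i))).

(* A full subcategory is given by its class of objects. *)
Definition subcat := obj C -> Prop.

Definition iso_closed (X : subcat) : Prop :=
  forall A B, isomorphic A B -> X A -> X B.

Definition summand_closed (X : subcat) : Prop :=
  forall D A, direct_summand D A -> X A -> X D.

Definition mor_class := forall A B, hom A B -> Prop.

Definition is_ideal (I : mor_class) : Prop :=
  [/\ forall A B, I A B 0,
      forall A B (f g : hom A B), I A B f -> I A B g -> I A B (f - g),
      forall A B D (g : hom B D) (f : hom A B), I A B f -> I A D (g \oc f)
    & forall A B D (g : hom B D) (f : hom A B), I B D g -> I A D (g \oc f)].

Definition factoring (X : subcat) : mor_class := fun A B f =>
  exists D (g : hom D B) (h : hom A D), X D /\ f = g \oc h.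

End Category.

(* An additive bifunctor C^op x C -> Ab.  Following the usual notation,        *)
(* [ext D A] is E(D, A), [push a] is a_* and [pull c] is c^*.                  *)
Record addBifunctor (C : preAddCat) := AddBifunctor {
  ext : C -> C -> zmodType;
  push : forall D A A' : C, hom A A' -> ext D A -> ext D A';
  pull : forall A D D' : C, hom D' D -> ext D A -> ext D' A;
  pushD : forall D A A' (a : hom A A') (d d' : ext D A),
    push a (d + d') = push a d + push a d';
  pullD : forall A D D' (c : hom D' D) (d d' : ext D A),
    pull c (d + d') = pull c d + pull c d';
  push_id : forall D A (d : ext D A), push (idm A) d = d;
  pull_id : forall D A (d : ext D A), pull (idm D) d = d;
  push_comp : forall D A A' A'' (a' : hom A' A'') (a : hom A A') (d : ext D A),
    push (a' \oc a) d = push a' (push a d);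
  pull_comp : forall A D D' D'' (c : hom D' D) (c' : hom D'' D') (d : ext D A),
    pull (c \oc c') d = pull c' (pull c d);
  push_pull : forall A A' D D' (a : hom A A') (c : hom D' D) (d : ext D A),
    push a (pull c d) = pull c (push a d);
  push_addm : forall D A A' (a a' : hom A A') (d : ext D A),
    push (a + a') d = push a d + push a' d;
  pull_addm : forall A D D' (c c' : hom D' D) (d : ext D A),
    pull (c + c') d = pull c d + pull c' d
}.

Section Realization.
Variables (C : preAddCat) (E : addBifunctor C).
Implicit Types A B D F M G : C.

(* [r A B D x y d] reads: the sequence A -x-> B -y-> D belongs to the class    *)
(* s(d).                                                                       *)
Definition realization_rel :=
  forall A B D : C, hom A B -> hom B D -> ext E D A -> Prop.

Definition seq_equiv A D B B' (x : hom A B) (y : hom B D)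
    (x' : hom A B') (y' : hom B' D) : Prop :=
  exists b : hom B B', [/\ is_iso b, b \oc x = x' & y' \oc b = y].

(* For each extension, [r] singles out exactly one equivalence class. *)
Definition realizes_one_class (r : realization_rel) : Prop :=
  (forall A D (d : ext E D A),
     exists B (x : hom A B) (y : hom B D), r A B D x y d) /\
  (forall A D (d : ext E D A) B B' (x : hom A B) (y : hom B D)
     (x' : hom A B') (y' : hom B' D),
     r A B D x y d -> (r A B' D x' y' d <-> seq_equiv x y x' y')).

Definition ext_mor A A' D D' (a : hom A A') (c : hom D D')
    (d : ext E D A) (d' : ext E D' A') : Prop :=
  push a d = pull c d'.

Definition triangle_mor A B D (x : hom A B) (y : hom B D) (d : ext E D A)
    A' B' D' (x' : hom A' B') (y' : hom B' D') (d' : ext E D' A')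
    (a : hom A A') (b : hom B B') (c : hom D D') : Prop :=
  [/\ ext_mor a c d d', b \oc x = x' \oc a & c \oc y = y' \oc b].

Definition realization_axiom (r : realization_rel) : Prop :=
  forall A B D (x : hom A B) (y : hom B D) (d : ext E D A)
    A' B' D' (x' : hom A' B') (y' : hom B' D') (d' : ext E D' A')
    (a : hom A A') (c : hom D D'),
    r A B D x y d -> r A' B' D' x' y' d' -> ext_mor a c d d' ->
    exists b : hom B B', triangle_mor x y d x' y' d' a b c.

Definition hom_sum A A' B B' (P : biprod A A') (Q : biprod B B')
    (f : hom A B) (f' : hom A' B') : hom P Q :=
  in1 Q \oc f \oc pr1 P + in2 Q \oc f' \oc pr2 P.

Definition ext_sum A A' D D' (P : biprod A A') (Q : biprod D D')
    (d : ext E D A) (d' : ext E D' A') : ext E Q P :=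
  push (in1 P) (pull (pr1 Q) d) + push (in2 P) (pull (pr2 Q) d').

Definition additive_realization (r : realization_rel) : Prop :=
  (forall A D (P : biprod A D), r A P D (in1 P) (pr2 P) 0) /\
  (forall A B D (x : hom A B) (y : hom B D) (d : ext E D A)
     A' B' D' (x' : hom A' B') (y' : hom B' D') (d' : ext E D' A')
     (P : biprod A A') (Q : biprod B B') (R : biprod D D'),
     r A B D x y d -> r A' B' D' x' y' d' ->
     r P Q R (hom_sum P Q x x') (hom_sum Q R y y') (ext_sum P R d d')).

Definition ET3 (r : realization_rel) : Prop :=
  forall A B D (x : hom A B) (y : hom B D) (d : ext E D A)
    A' B' D' (x' : hom A' B') (y' : hom B' D') (d' : ext E D' A')
    (a : hom A A') (b : hom B B'),
    r A B D x y d -> r A' B' D' x' y' d' -> b \oc x = x' \oc a ->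
    exists c : hom D D', triangle_mor x y d x' y' d' a b c.

Definition ET3op (r : realization_rel) : Prop :=
  forall A B D (x : hom A B) (y : hom B D) (d : ext E D A)
    A' B' D' (x' : hom A' B') (y' : hom B' D') (d' : ext E D' A')
    (b : hom B B') (c : hom D D'),
    r A B D x y d -> r A' B' D' x' y' d' -> c \oc y = y' \oc b ->
    exists a : hom A A', triangle_mor x y d x' y' d' a b c.

(*   A -f-> B -f'-> D                                                          *)
(*   |      |g      |u                                                         *)
(*   A -h-> M -h'-> G        with h = g f                                      *)
(*          |g'     |v                                                         *)
(*          F ----- F                                                          *)
Definition ET4 (r : realization_rel) : Prop :=
  forall A B D M F (f : hom A B) (f' : hom B D) (d : ext E D A)
    (g : hom B M) (g' : hom M F) (d' : ext E F B),
    r A B D f f' d -> r B M F g g' d' ->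
    exists G (h' : hom M G) (u : hom D G) (v : hom G F) (d'' : ext E G A),
      [/\ r A M G (g \oc f) h' d'',
          h' \oc g = u \oc f' /\ v \oc h' = g',
          r D G F u v (push f' d'),
          pull u d'' = d
        & push f d'' = pull v d'].

(*   D -u-> G -v-> F                                                           *)
(*   |      |h'    |g'                                                         *)
(*   D -f'> A -f-> B                                                           *)
(*          |h     |g        with h = g f                                      *)
(*          M ---- M                                                           *)
Definition ET4op (r : realization_rel) : Prop :=
  forall D A B F M (f' : hom D A) (f : hom A B) (d : ext E B D)
    (g' : hom F B) (g : hom B M) (d' : ext E M F),
    r D A B f' f d -> r F B M g' g d' ->
    exists G (h' : hom G A) (u : hom D G) (v : hom G F) (d'' : ext E M G),
      [/\ r G A M h' (g \oc f) d'',
          h' \oc u = f' /\ f \oc h' = g' \oc v,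
          r D G F u v (pull g' d),
          push v d'' = d'
        & push u d = pull g d''].

End Realization.

Record extriCat := ExtriCat {
  carrier :> preAddCat;
  carrier_additive : is_additive carrier;
  EE : addBifunctor carrier;
  realizes : realization_rel EE;
  realizes_class : realizes_one_class realizes;
  realizes_mor : realization_axiom realizes;
  realizes_additive : additive_realization realizes;
  et3 : ET3 realizes;
  et3op : ET3op realizes;
  et4 : ET4 realizes;
  et4op : ET4op realizes
}.

Section Cotorsion.
Variable C : extriCat.

Notation Ext := (ext (EE C)).

Definition triangle (A B D : C) (x : hom A B) (y : hom B D) (d : Ext D A) :
  Prop := realizes x y d.

Definition complete_cotorsion_pair (X Y : subcat C) : Prop :=
  [/\ (iso_closed X /\ summand_closed X) /\ (iso_closed Y /\ summand_closed Y),
      forall A B : C, X A -> Y B -> forall d : Ext A B, d = 0,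
      forall M : C, exists (B A : C) (x : hom B A) (y : hom A M) (d : Ext M B),
        [/\ X A, Y B & triangle x y d]
    & forall M : C, exists (B A : C) (x : hom M B) (y : hom B A) (d : Ext A M),
        [/\ X A, Y B & triangle x y d]].

Definition ext_map (A B A' B' : C) (i : hom A B) (j : hom A' B')
  (d : Ext B A') : Ext A B' := push j (pull i d).

Definition left_perp (S : mor_class C) : mor_class C := fun A B f =>
  forall (A' B' : C) (s : hom A' B'), S A' B' s ->
  forall d, ext_map f s d = 0.

Definition right_perp (S : mor_class C) : mor_class C := fun A B g =>
  forall (A' B' : C) (s : hom A' B'), S A' B' s ->
  forall d, ext_map s g d = 0.

(* [f] is a deflation because it is the second map of the triangle (k, f).     *)
Definition special_precover (I : mor_class C) (X M : C) (f : hom X M) : Prop :=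
  I X M f /\
  exists (A B : C) (x : hom A B) (y : hom B M) (l : Ext M A)
         (K : C) (k : hom K X) (h : hom A K) (b : hom B X),
    [/\ triangle x y l,
        right_perp I h,
        triangle k f (push h l)
      & triangle_mor x y l k f (push h l) h b (idm M)].

(* [g] is an inflation because it is the first map of the triangle (g, p).     *)
Definition special_preenvelope (J : mor_class C) (M Y : C) (g : hom M Y) :
  Prop :=
  J M Y g /\
  exists (A B : C) (x : hom M A) (y : hom A B) (d : Ext B M)
         (D : C) (p : hom Y D) (h : hom D B) (b : hom Y A),
    [/\ triangle x y d,
        left_perp J h,
        triangle g p (pull h d)
      & triangle_mor g p (pull h d) x y d (idm M) b h].

Definition special_precovering (I : mor_class C) : Prop :=
  forall M : C, exists (X : C) (f : hom X M), special_precover I f.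

Definition special_preenveloping (J : mor_class C) : Prop :=
  forall M : C, exists (Y : C) (g : hom M Y), special_preenvelope J g.

Definition ideal_cotorsion_pair (I J : mor_class C) : Prop :=
  [/\ is_ideal I, is_ideal J,
      forall (A B : C) (f : hom A B), right_perp I f <-> J A B f
    & forall (A B : C) (f : hom A B), I A B f <-> left_perp J f].

Definition complete_ideal_cotorsion_pair (I J : mor_class C) : Prop :=
  [/\ ideal_cotorsion_pair I J, special_precovering I
    & special_preenveloping J].

End Cotorsion.

(* Main.v *)
(** The vanishing condition of a cotorsion pair comes from identity morphisms.
    For the approximations, let K -> B -> M be the triangle of a special
    [X]-precover f : B -> M, with class d.  As d is the push-out of an extension
    along a map of [X]^perp, it is killed by pull-back along every map from an
    object of X to M, and this property survives the removal from K of any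
    summand of B on which f vanishes.  Removing them all makes f right minimal:
    f g = f forces g to be invertible.  Since f factors through X and maps from
    X lift along f, minimality makes B a retract of an object of X, and
    Wakamatsu's argument then gives E(X, K) = 0, so K is in Y.  The preenvelope
    half follows by passing to the opposite extriangulated category. *)

From Stdlib Require Import Classical.
From mathcomp Require Import all_boot all_algebra.
Require Import Defs.

Set Implicit Arguments.
Unset Strict Implicit.
Unset Printing Implicit Defensive.

Import GRing.Theory.

Local Open Scope ring_scope.

(** * Bilinearity of composition *)

Section PreAdditive.
Variable C : preAddCat.
Implicit Types A B D : C.

Lemma comp0m A B D (f : hom A B) : (0 : hom B D) \oc f = 0.
Proof. by apply: (addrI (0 \oc f)); rewrite -compDl !addr0. Qed.

Lemma compm0 A B D (g : hom B D) : g \oc (0 : hom A B) = 0.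
Proof. by apply: (addrI (g \oc 0)); rewrite -compDr !addr0. Qed.

Lemma compNm A B D (g : hom B D) (f : hom A B) : (- g) \oc f = - (g \oc f).
Proof. by apply: (addrI (g \oc f)); rewrite -compDl !subrr comp0m. Qed.

Lemma compmN A B D (g : hom B D) (f : hom A B) : g \oc (- f) = - (g \oc f).
Proof. by apply: (addrI (g \oc f)); rewrite -compDr !subrr compm0. Qed.

Lemma comp_suml A B D n (g : 'I_n -> hom B D) (f : hom A B) :
  (\sum_i g i) \oc f = \sum_i g i \oc f.
Proof.
by elim/big_ind2: _ => [|x1 x2 y1 y2 <- <-|//]; rewrite ?comp0m ?compDl.
Qed.

Lemma comp_sumr A B D n (g : hom B D) (f : 'I_n -> hom A B) :
  g \oc (\sum_i f i) = \sum_i g \oc f i.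
Proof.
by elim/big_ind2: _ => [|x1 x2 y1 y2 <- <-|//]; rewrite ?compm0 ?compDr.
Qed.

Definition compE := (compDl, compDr, compNm, compmN, comp0m, compm0, comp1m,
  compm1).

Lemma compK A B D F (g : hom B D) (f : hom A B) (h : hom A D) (k : hom F A) :
  g \oc f = h -> g \oc (f \oc k) = h \oc k.
Proof. by rewrite compA => ->. Qed.

Lemma is_iso_id A : is_iso (idm A).
Proof. by exists (idm A); rewrite comp1m. Qed.

Lemma isomorphic_refl A : isomorphic A A.
Proof. by exists (idm A); apply: is_iso_id. Qed.

(** * Local endomorphism rings and finite sums of local objects *)

Lemma idem_iso A (e : hom A A) : e \oc e = e -> is_iso e -> e = idm A.
Proof. by move=> ee [g [ge _]]; rewrite -[e]comp1m -ge -compA ee. Qed.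

(** With [h] inverse to [g f], the endomorphism [e = f h g] of [B] is idempotent. As [B] is local,
    [e] or [1 - e] is invertible, hence the identity; [e = 0] would give [idm A = 0]. *)
Lemma local_end_comp_iso A B (f : hom A B) (g : hom B A) :
  local_end A -> local_end B -> is_iso (g \oc f) -> is_iso f.
Proof.
move=> [A0 _] [_ locB] [h [hgf gfh]].
pose e := f \oc h \oc g.
have ee : e \oc e = e.
  by rewrite /e -!compA (compA g) (compA (g \oc f)) gfh comp1m.
have : is_iso (e + (idm B - e)) by rewrite addrC subrK; apply: is_iso_id.
case/locB => [ie|ine].
  exists (h \oc g); rewrite -compA hgf; split=> //.
  by rewrite compA; apply: idem_iso.
have e0 : e = 0.
  have h1 : idm B - e = idm B.
    apply: idem_iso => //.
    by rewrite compDl comp1m compNm compDr compm1 compmN ee subrr oppr0 addr0.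
  by rewrite -[e](subKr (idm B)) h1 subrr.
case: A0; have -> : idm A = h \oc g \oc e \oc f.
  by rewrite -[LHS]comp1m -hgf /e !compA.
by rewrite e0 !compE.
Qed.

(** The equations of [biprod] for maps on a fixed object, so that a single inclusion can be
    exchanged. *)
Definition is_biprod A B D (i1 : hom A D) (i2 : hom B D) (p1 : hom D A)
    (p2 : hom D B) : Prop :=
  [/\ p1 \oc i1 = idm A, p2 \oc i2 = idm B, p1 \oc i2 = 0, p2 \oc i1 = 0
    & i1 \oc p1 + i2 \oc p2 = idm D].

Lemma biprod_is_biprod A B (P : biprod A B) :
  is_biprod (in1 P) (in2 P) (pr1 P) (pr2 P).
Proof. by case: P. Qed.

(** Summands are split off one at a time; their number is the measure for later inductions. *)
Inductive local_sum : nat -> C -> Prop :=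
| local_sum0 B : is_zero B -> local_sum 0 B
| local_sumS n A B D (i1 : hom A D) (i2 : hom B D) (p1 : hom D A)
    (p2 : hom D B) :
    is_biprod i1 i2 p1 p2 -> local_end A -> local_sum n B ->
    local_sum n.+1 D.

Lemma local_sum_iso n A B : isomorphic A B -> local_sum n A -> local_sum n B.
Proof.
move=> [f [g [gf fg]]] sA.
case: n A / sA f g gf fg => [A A0|n A1 A2 A i1 i2 p1 p2 PA locA sA2] f g gf fg.
  apply: local_sum0 => D h k; split.
    by rewrite -[h]compm1 -fg compA; case: (A0 _ (h \oc f) 0) => ->;
      rewrite comp0m.
  by rewrite -[k]comp1m -fg -compA; case: (A0 _ 0 (g \oc k)) => _ ->;
    rewrite compm0.
case: PA => e11 e22 e12 e21 es.
apply: (@local_sumS _ A1 A2 B (f \oc i1) (f \oc i2) (p1 \oc g)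
  (p2 \oc g)) => //.
split; rewrite -?compA ?(compK _ gf) ?comp1m //.
by rewrite -compDr !(compA _ _ g) -compDl es comp1m.
Qed.

(* Only part of a biproduct: the idempotent [\sum_i fi i \oc pi i] splits      *)
(* through a sum of local objects, whether or not it is the identity.          *)
Lemma local_sum_partial (hadd : is_additive C) n (s : 'I_n -> C) B
    (fi : forall i, hom (s i) B) (pi : forall i, hom B (s i)) :
  (forall i, local_end (s i)) ->
  (forall i, pi i \oc fi i = idm (s i)) ->
  (forall i j, i != j -> pi j \oc fi i = 0) ->
  exists S (e : hom S B) (p : hom B S),
    [/\ p \oc e = idm S, e \oc p = \sum_i fi i \oc pi i & local_sum n S].
Proof.
case: hadd => [[Z Z0] hP].
elim: n => [|n IHn] in s fi pi * => locs eii eij.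
  exists Z, 0, 0; split; last exact: local_sum0.
    by case: (Z0 Z (idm Z) 0) => ->; rewrite comp0m.
  by rewrite big_ord0 comp0m.
have [|S [e [p [pe ep sS]]]] := IHn (fun i => s (lift ord0 i))
  (fun i => fi (lift ord0 i)) (fun i => pi (lift ord0 i)) (fun i => locs _)
  (fun i => eii _).
  by move=> i j ij; apply: eij; rewrite (inj_eq lift_inj).
case: (hP (s ord0) S) => P.
(* [e = (e p) e], where [e p] is the sum over the indices other than [ord0]. *)
have p0e : pi ord0 \oc e = 0.
  rewrite -[e]compm1 -pe (compA e) ep compA comp_sumr big1 ?comp0m // => i _.
  by rewrite compA eij ?comp0m // eq_sym neq_lift.
have pe0 : p \oc fi ord0 = 0.
  rewrite -[p]comp1m -pe -(compA p) ep -compA comp_suml big1 ?compm0 // => i _.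
  by rewrite -compA eij ?compm0 // neq_lift.
case: (biprod_is_biprod P) => e11 e22 e12 e21 es.
exists P, (fi ord0 \oc pr1 P + e \oc pr2 P), (in1 P \oc pi ord0 + in2 P \oc p).
split.
- rewrite !compE -!compA !(compA (pi _)) !(compA p) eii p0e pe0 pe !compE.
  by rewrite addr0 add0r.
- rewrite big_ord_recl -ep !compE -!compA !(compA (pr1 _)) !(compA (pr2 _)).
  by rewrite e11 e22 e12 e21 !compE addr0 add0r.
by apply: (local_sumS (biprod_is_biprod P)).
Qed.

Lemma krull_schmidt_local_sum : is_additive C -> krull_schmidt C ->
  forall A, exists n, local_sum n A.
Proof.
move=> hadd [hks _] A; case: (hks A) => n [s [locs [T isoTA]]].
have [|S [e [p [pe ep sS]]]] :=
  local_sum_partial hadd _ (@fpr_fin _ _ _ T) (@fpr_fin0 _ _ _ T).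
  by move=> i; case: (locs i).
exists n; apply: (local_sum_iso isoTA); apply: local_sum_iso sS.
by exists e, p; rewrite ep fin_fpr.
Qed.

(** * Exchange of local summands *)

Lemma biprod_swap A A' B D (i1 : hom A D) (i2 : hom B D) (p1 : hom D A)
    (p2 : hom D B) (s : hom A' D) :
  is_biprod i1 i2 p1 p2 -> is_iso (p1 \oc s) ->
  exists p q, is_biprod s i2 p q.
Proof.
move=> [e11 e22 e12 e21 es] [g [gps psg]].
(* The columns [s] and [i2] form a triangular matrix with diagonal entries [p1 s] and 1; these are
   the rows of its inverse. *)
exists (g \oc p1), (p2 - p2 \oc s \oc g \oc p1); split.
- by rewrite -compA.
- by rewrite !compE -!compA e12 e22 !compm0 subr0.
- by rewrite -compA e12 compm0.
- by rewrite !compE -!compA gps compm1 subrr.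
have h : i1 \oc p1 \oc s = s - i2 \oc p2 \oc s.
  by apply/eqP; rewrite eq_sym subr_eq -compDl es comp1m.
have -> : s \oc (g \oc p1) = i1 \oc p1 + i2 \oc p2 \oc s \oc g \oc p1.
  by rewrite -[s in LHS](subrK (i2 \oc p2 \oc s)) -h !compE -!compA (compA p1 s)
     (compA _ g) psg comp1m.
by rewrite !compE !compA addrACA addrN addr0.
Qed.

(** The invertible [t s] is the sum of its parts through [A1] and [B1], so one part is invertible.
    In the first case [s] replaces [i1]; in the second, induction splits [A] off [B1] and [A1] joins
    the complement. *)
Lemma local_sum_exchange (hadd : is_additive C) n A B (s : hom A B)
    (t : hom B A) :
  local_end A -> local_sum n B -> is_iso (t \oc s) ->
  exists m B' (i : hom B' B) (p : hom B A) (q : hom B B'),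
    [/\ n = m.+1, local_sum m B' & is_biprod s i p q].
Proof.
move=> locA sB; elim: sB => {n B} [B B0|n A1 B1 B i1 i2 p1 p2 PB locA1 sB1 IH]
  in s t * => ts.
  case: (locA) => A0 _; case: A0; case: ts => g [<- _].
  by case: (B0 _ 0 s) => _ ->; rewrite !compm0.
case: (PB) => e11 e22 e12 e21 es.
have : is_iso (t \oc i1 \oc (p1 \oc s) + t \oc i2 \oc (p2 \oc s)).
  by rewrite -!compA -compDr !(compA _ _ s) -compDl es comp1m.
case/(proj2 locA) => [ts1|ts2].
  have /(biprod_swap PB) [p [q P]] := local_end_comp_iso locA locA1 ts1.
  by exists n, B1, i2, p, q.
case: (IH _ _ ts2) => m [B' [i [p [q [-> sB' [f11 f22 f12 f21 fs]]]]]].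
case: (proj2 hadd A1 B') => Q.
case: (biprod_is_biprod Q) => g11 g22 g12 g21 gs.
have P0 : is_biprod (i2 \oc (p2 \oc s)) (i1 \oc pr1 Q + i2 \oc i \oc pr2 Q)
    (p \oc p2) (in1 Q \oc p1 + in2 Q \oc q \oc p2).
  split; rewrite ?compE -!compA ?(compK _ e11) ?(compK _ e12) ?(compK _ e21)
    ?(compK _ e22) ?compE.
  - by [].
  - by rewrite (compK _ f22) comp1m addr0 add0r.
  - by rewrite (compK _ f12) comp0m addr0.
  - by rewrite f21 compm0 addr0.
  rewrite !(compK _ g11) !(compK _ g22) !(compK _ g12) !(compK _ g21) !compE.
  rewrite addr0 add0r addrCA -compDr.
  suff -> : p2 \oc (s \oc (p \oc p2)) + i \oc (q \oc p2) = p2 by [].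
  by rewrite -[RHS]comp1m -fs !compE -!compA.
(* [P0] embeds [A] by [i2 p2 s]; as [p p2 s] is the identity, [s] may replace this inclusion. *)
case: (biprod_swap P0 (s := s)) => [|p' [q' P']].
  by rewrite -compA f11; apply: is_iso_id.
exists m.+1, Q, (i1 \oc pr1 Q + i2 \oc i \oc pr2 Q), p', q'; split=> //.
by apply: (local_sumS (biprod_is_biprod Q)).
Qed.

(** A complement is built by exchanging the local summands of [K] into [B] one by one. *)
Lemma retract_direct_summand (hadd : is_additive C)
    (hks : forall A, exists n, local_sum n A) K B (s : hom K B) (r : hom B K) :
  r \oc s = idm K -> direct_summand K B.
Proof.
suff h : r \oc s = idm K ->
    exists B' (i1 : hom K B) (i2 : hom B' B) p1 p2, is_biprod i1 i2 p1 p2.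
  case/h => B' [i1 [i2 [p1 [p2 [h11 h22 h12 h21 hs]]]]].
  by exists B', (Biprod h11 h22 h12 h21 hs); apply: isomorphic_refl.
case: (hks K) => n sK.
elim: n K / sK B s r => [K K0|n A K1 K i1 i2 p1 p2 PK locA _ IH] B s r rs.
  exists B, 0, (idm B), 0, (idm B).
  by split; rewrite ?compE ?add0r //; case: (K0 K (idm K) 0) => ->.
case: PK => e11 e22 e12 e21 es.
case: (hks B) => k sB.
have [|m [B1 [i [p [q [_ _ [f11 f22 f12 f21 fs]]]]]]] :=
  @local_sum_exchange hadd _ _ _ (s \oc i1) (p1 \oc r) locA sB.
  by rewrite -compA (compK _ rs) comp1m e11; apply: is_iso_id.
have iq : i \oc q = idm B - s \oc i1 \oc p by rewrite -fs addrC addKr.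
(* [K1] is still a retract of [B1]: the part [s i1 p] of [idm B] that is lost is killed by
   [p2 r]. *)
have [|B2 [j1 [j2 [u1 [u2 [g11 g22 g12 g21 gs]]]]]] :=
  IH B1 (q \oc s \oc i2) (p2 \oc r \oc i).
  rewrite -!compA (compA i) iq !compE -!compA !(compK _ rs) !compE.
  by rewrite (compK _ e21) !compE subr0.
exists B2, (s \oc i1 \oc p1 + i \oc j1 \oc p2), (i \oc j2),
  (i1 \oc p + i2 \oc u1 \oc q), (u2 \oc q).
have h11 F (f : hom F A) : p \oc (s \oc (i1 \oc f)) = f.
  by rewrite !compA -(compA p) f11 comp1m.
have h21 F (f : hom F A) : q \oc (s \oc (i1 \oc f)) = 0.
  by rewrite !compA -(compA q) f21 comp0m.
split; rewrite ?compE -?compA ?h11 ?h21 ?(compK _ f12) ?(compK _ f22)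
  ?(compK _ e11) ?(compK _ e12) ?(compK _ e21) ?(compK _ e22) ?compE.
- by rewrite (compK _ g11) comp1m addr0 add0r.
- by [].
- by rewrite g12 !compE addr0.
- by rewrite (compK _ g21) comp0m addr0.
rewrite addr0 add0r -addrA -compDr !(compA _ _ q) -compDl gs comp1m.
by rewrite compA.
Qed.

(* Gaussian elimination: [x] and [y] clear the off-diagonal entries of [g]. *)
Lemma is_iso_schur A B D (i1 : hom A D) (i2 : hom B D) (p1 : hom D A)
    (p2 : hom D B) (g : hom D D) (c : hom A A) :
  is_biprod i1 i2 p1 p2 ->
  c \oc (p1 \oc g \oc i1) = idm A -> (p1 \oc g \oc i1) \oc c = idm A ->
  is_iso (p2 \oc g \oc i2 - p2 \oc g \oc i1 \oc c \oc p1 \oc g \oc i2) ->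
  is_iso g.
Proof.
move=> [e11 e22 e12 e21 es] cg gc [S' [S'S SS']].
move: S'S SS'; set S := _ - _ => S'S SS'.
pose x := i2 - i1 \oc c \oc p1 \oc g \oc i2.
pose y := p2 - p2 \oc g \oc i1 \oc c \oc p1.
have gx : g \oc x = i2 \oc S.
  rewrite -[LHS]comp1m -es compDl -!compA.
  have -> : p2 \oc (g \oc x) = S by rewrite /x /S !compE !compA.
  have -> : p1 \oc (g \oc x) = 0.
    by rewrite /x !compE !compA gc comp1m subrr.
  by rewrite compm0 add0r.
have yg : y \oc g = S \oc p2.
  rewrite -[LHS]compm1 -es compDr !compA.
  have -> : y \oc g \oc i2 = S by rewrite /y /S !compE.
  have -> : y \oc g \oc i1 = 0.
    by rewrite /y !compE -!compA; rewrite -!compA in cg;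
      rewrite cg compm1 subrr.
  by rewrite comp0m add0r.
have cpg : c \oc p1 \oc g = p1 + c \oc p1 \oc g \oc i2 \oc p2.
  by rewrite -[LHS]compm1 -es compDr !compA -(compA c) -(compA c) cg comp1m.
have gic : g \oc i1 \oc c = i1 + i2 \oc p2 \oc g \oc i1 \oc c.
  by rewrite -[LHS]comp1m -es compDl -!compA; rewrite -!compA in gc;
    rewrite gc compm1.
(* The block inverse formula, with [S'] inverse to the Schur complement. *)
exists (i1 \oc c \oc p1 + x \oc S' \oc y); split.
  rewrite compDl -!compA yg (compA S') S'S comp1m (compA c) cpg /x !compE.
  by rewrite -!compA addrACA subrr addr0.
rewrite compDr !compA gx -(compA i2) SS' compm1 gic /y !compE.
by rewrite !compA addrACA subrr addr0.
Qed.

(* If no [v \oc a \oc u] through a local object is invertible, then [a] lies *)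
(* in the radical of the endomorphism ring of [D].                           *)
Lemma one_minus_iso_or_local n D (a : hom D D) : local_sum n D ->
  is_iso (idm D - a) \/
  exists A (u : hom A D) (v : hom D A), local_end A /\ is_iso (v \oc a \oc u).
Proof.
move=> sD; elim: n D / sD a => [D D0|n A B D i1 i2 p1 p2 PD locA _ IH] a.
  left; case: (D0 D (idm D - a) 0) => -> _.
  by exists 0; case: (D0 D (idm D) 0) => -> _; rewrite comp0m.
case: (PD) => e11 e22 e12 e21 es.
have : is_iso (p1 \oc a \oc i1 + (idm A - p1 \oc a \oc i1)).
  by rewrite addrC subrK; apply: is_iso_id.
case/(proj2 locA) => [ia|[c []]]; first by right; exists A, i1, p1.
have <- : p1 \oc (idm D - a) \oc i1 = idm A - p1 \oc a \oc i1.
  by rewrite !compE e11.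
move=> cg gc.
(* [idm B] minus this map is the Schur complement of [idm D - a]. *)
case: (IH (p2 \oc a \oc i2 + p2 \oc a \oc i1 \oc c \oc p1 \oc a \oc i2)).
  move=> iS; left; apply: (is_iso_schur PD cg gc).
  have -> : p2 \oc (idm D - a) \oc i1 = - (p2 \oc a \oc i1).
    by rewrite !compE e21 sub0r.
  have h12 : p1 \oc (idm D - a) \oc i2 = - (p1 \oc a \oc i2).
    by rewrite !compE e12 sub0r.
  rewrite -!compA (compA p1) h12 !compE opprK e22 -!compA -addrA -opprD.
  by rewrite -!compA in iS.
move=> [A' [u [v [locA']]]].
rewrite !compE => /(proj2 locA') [] iv; right; exists A'.
  by exists (i2 \oc u), (v \oc p2); rewrite !compA in iv *.
exists (i1 \oc c \oc p1 \oc a \oc i2 \oc u), (v \oc p2).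
by rewrite !compA in iv *.
Qed.
End PreAdditive.

(** * Exactness properties of triangles *)

Section Triangles.
Variable T : extriCat.
Implicit Types A B D K M : T.

Notation Ext := (ext (EE T)).

Lemma push0m A A' D (d : Ext D A) : push (0 : hom A A') d = 0.
Proof. by apply: (addrI (push 0 d)); rewrite -push_addm !addr0. Qed.

Lemma pull0m A D D' (d : Ext D A) : pull (0 : hom D' D) d = 0.
Proof. by apply: (addrI (pull 0 d)); rewrite -pull_addm !addr0. Qed.

Lemma pushm0 A A' D (a : hom A A') : push a (0 : Ext D A) = 0.
Proof. by apply: (addrI (push a 0)); rewrite -pushD !addr0. Qed.

Lemma pullm0 A D D' (c : hom D' D) : pull c (0 : Ext D A) = 0.
Proof. by apply: (addrI (pull c 0)); rewrite -pullD !addr0. Qed.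

Lemma triangle_exists A D (d : Ext D A) :
  exists B (x : hom A B) (y : hom B D), triangle x y d.
Proof. exact: (proj1 (realizes_class T)). Qed.

(** Here [Z] is a zero object. Comparing a triangle with this split one, or with that of
    [triangle_idr], turns the axioms into exactness statements. *)
Lemma triangle_idl A : exists Z, triangle (idm A) (0 : hom A Z) 0.
Proof.
have [[Z Z0] _] := carrier_additive T; exists Z.
have z : (0 : hom A Z) \oc (0 : hom Z A) = idm Z.
  by rewrite comp0m; case: (Z0 Z (idm Z) 0) => ->.
by apply: (proj1 (realizes_additive T) A Z
  (@Biprod _ A Z A (idm A) 0 (idm A) 0 _ z _ _ _)); rewrite ?compE ?addr0.
Qed.

Lemma triangle_idr A : exists Z, triangle (0 : hom Z A) (idm A) 0.
Proof.
have [[Z Z0] _] := carrier_additive T; exists Z.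
have z : (0 : hom A Z) \oc (0 : hom Z A) = idm Z.
  by rewrite comp0m; case: (Z0 Z (idm Z) 0) => ->.
by apply: (proj1 (realizes_additive T) Z A
  (@Biprod _ Z A A 0 (idm A) 0 (idm A) z _ _ _ _)); rewrite ?compE ?add0r.
Qed.

Section Exactness.
Variables (K B M : T) (k : hom K B) (f : hom B M) (d : Ext M K).
Hypothesis tr : triangle k f d.

Lemma triangle_comp0 : f \oc k = 0.
Proof.
have [Z trZ] := triangle_idl K.
have [|c [_ _]] := @et3 T _ _ _ _ _ _ _ _ _ _ _ _ (idm K) k trZ tr.
  by rewrite !compm1.
by rewrite compm0.
Qed.

Lemma triangle_lift A (g : hom A B) : f \oc g = 0 -> exists m, g = k \oc m.
Proof.
move=> fg; have [Z trZ] := triangle_idl A.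
have [|m [_ h _]] := @et3op T _ _ _ _ _ _ _ _ _ _ _ _ g 0 trZ tr.
  by rewrite compm0 fg.
by exists m; rewrite -h compm1.
Qed.

Lemma triangle_lift_defl A (c : hom A M) : pull c d = 0 ->
  exists w, f \oc w = c.
Proof.
move=> dc; have [Z trZ] := triangle_idr A.
have [|w [_ _ h]] := @realizes_mor T _ _ _ _ _ _ _ _ _ _ _ _ 0 c trZ tr.
  by rewrite /ext_mor pushm0 dc.
by exists w; rewrite -h compm1.
Qed.

Lemma triangle_extend A (a : hom K A) : push a d = 0 ->
  exists b, b \oc k = a.
Proof.
move=> da; have [Z trZ] := triangle_idl A.
have [|b [_ h _]] := @realizes_mor T _ _ _ _ _ _ _ _ _ _ _ _ a 0 tr trZ.
  by rewrite /ext_mor pullm0 da.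
by exists b; rewrite h comp1m.
Qed.

Lemma triangle_push0 : push k d = 0.
Proof.
have [Z trZ] := triangle_idl B.
have [|c [+ _ _]] := @et3 T _ _ _ _ _ _ _ _ _ _ _ _ k (idm B) tr trZ => //.
by rewrite /ext_mor pullm0.
Qed.

Lemma triangle_split (r : hom B K) : r \oc k = idm K -> d = 0.
Proof.
move=> rk; have [Z trZ] := triangle_idl K.
have [|c [+ _ _]] := @et3 T _ _ _ _ _ _ _ _ _ _ _ _ (idm K) r tr trZ.
  by rewrite rk compm1.
by rewrite /ext_mor pullm0 push_id.
Qed.

(** Since [push k t = 0], the map [k] extends over the middle term of a triangle of [t]; (ET3)
    completes this to a morphism of triangles with identity on [K]. *)
Lemma triangle_push_exact D (t : Ext D K) : push k t = 0 ->
  exists c, t = pull c d.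
Proof.
move=> kt; have [W [x [y trt]]] := triangle_exists t.
have [Z trZ] := triangle_idl B.
have [|b [_ h _]] := @realizes_mor T _ _ _ _ _ _ _ _ _ _ _ _ k 0 trt trZ.
  by rewrite /ext_mor pullm0 kt.
have [|c [+ _ _]] := @et3 T _ _ _ _ _ _ _ _ _ _ _ _ (idm K) b trt tr.
  by rewrite h comp1m compm1.
by rewrite /ext_mor push_id; exists c.
Qed.

(* (ET4)op replaces the middle part of the long exact sequence of [ext _ F]. *)
Lemma ext0_extension F : (forall t : Ext K F, t = 0) ->
  (forall t : Ext M F, t = 0) -> forall t : Ext B F, t = 0.
Proof.
move=> K0 M0 t; have [W [x [y trt]]] := triangle_exists t.
have [G [h' [u [v [t' [_ _]]]]]] := @et4op T _ _ _ _ _ _ _ _ _ _ _ trt tr.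
(* The triangle of [pull k t = 0] splits, and a retraction [r] of [u] turns [push u t = pull f t']
   into [t = pull f (push r t')]. *)
rewrite (K0 (pull k t)) => trG _ ut.
have [Z trZ] := triangle_idl F.
have [|r [_ + _]] :=
  @realizes_mor T _ _ _ _ _ _ _ _ _ _ _ _ (idm F) 0 trG trZ.
  by rewrite /ext_mor pushm0 pullm0.
rewrite comp1m => ru.
by rewrite -[t]push_id -ru push_comp ut push_pull (M0 (push r t')) pullm0.
Qed.

End Exactness.

(* Induction on the number of local summands of [K]: if [f] is not right      *)
(* minimal, then it vanishes on a local summand of [B]; this lifts to a       *)
(* summand [m] of [K], and [d] comes from the complement of [m].              *)
Lemma right_minimal_triangle (hks : forall A, exists n, local_sum n A)
    (X : subcat T) K B M (k : hom K B) (f : hom B M) (d : Ext M K) :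
  triangle k f d -> factoring X f ->
  (forall A, X A -> forall c : hom A M, pull c d = 0) ->
  exists K' B' (k' : hom K' B') (f' : hom B' M) (d' : Ext M K'),
    [/\ triangle k' f' d', factoring X f',
        forall A, X A -> forall c : hom A M, pull c d' = 0
      & forall g, f' \oc g = f' -> is_iso g].
Proof.
have [n] := hks K; elim/ltn_ind: n K B k f d => n IH K B k f d sK tr Xf Xd.
case: (classic (forall g, f \oc g = f -> is_iso g)) => [min|].
  by exists K, B, k, f, d.
case/not_all_ex_not=> g gN.
have [fg {}gN] := imply_to_and _ _ gN.
have [nB sB] := hks B.
(* As [g] is not invertible, [v (1 - g) u] is invertible for some local [A]; since [f (1 - g) = 0],
   the map [(1 - g) u] lifts to [m], and [A] splits off [K]. *)
have [|[A [u [v [locA]]]]] := one_minus_iso_or_local (idm B - g) sB.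
  by rewrite subKr.
have [|m au] := triangle_lift tr (g := (idm B - g) \oc u).
  by rewrite compA !compE fg subrr.
rewrite -compA au compA => vkm.
have [n' [K' [i [p [q [nE sK' [_ qi pi qm mp]]]]]]] :=
  local_sum_exchange (carrier_additive T) locA sK vkm.
case: vkm => w [wvkm _].
(* [i] is corrected so that its push-forward recovers [d], not only [d] up to *)
(* the component [push p d].                                                 *)
have jq : (i - m \oc w \oc v \oc k \oc i) \oc q + m \oc w \oc v \oc k = idm K.
  have iq : i \oc q = idm K - m \oc p by rewrite -mp addrC addKr.
  have wvkmE F (x : hom F A) : w \oc (v \oc (k \oc (m \oc x))) = x.
    by rewrite -[RHS]comp1m -wvkm -!compA.
  rewrite compDl compNm -!compA iq !compE wvkmE opprB addrA subrK.
  by rewrite subrK.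
have [B' [k' [f' tr']]] := triangle_exists (push q d).
have Xf' : factoring X f'.
  (* A morphism over the identity of [M] gives [f' = f b]; it exists because [push k d = 0] kills
     the part of [d] through [k]. *)
  have [|b [_ _ h]] := @realizes_mor T _ _ _ _ _ _ _ _ _ _ _ _
    (i - m \oc w \oc v \oc k \oc i) (idm M) tr' tr.
    rewrite /ext_mor pull_id -[RHS]push_id -jq [RHS]push_addm !push_comp.
    by rewrite (triangle_push0 tr) !pushm0 addr0.
  case: Xf => D [g1 [g2 [XD fE]]]; exists D, g1, (g2 \oc b).
  by rewrite compA -fE -h comp1m.
apply: (IH n' _ K' B' k' f' (push q d)); rewrite ?nE // => A' XA' c.
by rewrite -push_pull Xd ?pushm0.
Qed.

(** * Covers from a pair of mutually orthogonal classes *)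

Section HalfCotorsion.
Variables X Y : subcat T.
Hypothesis XY0 : forall A B, X A -> Y B -> forall t : Ext A B, t = 0.
Hypothesis Xperp :
  forall A, (forall B, Y B -> forall t : Ext A B, t = 0) -> X A.
Hypothesis Yperp :
  forall B, (forall A, X A -> forall t : Ext A B, t = 0) -> Y B.

Lemma right_minimal_cover K B M (k : hom K B) (f : hom B M) (d : Ext M K) :
  triangle k f d -> factoring X f ->
  (forall A, X A -> forall c : hom A M, pull c d = 0) ->
  (forall g, f \oc g = f -> is_iso g) -> X B /\ Y K.
Proof.
move=> tr [D [v [u [XD fE]]]] Xd fmin.
have XB : X B.
  (* By minimality [w u] is invertible, so [B] is a retract of [D]. *)
  have [w fw] := triangle_lift_defl tr (Xd D XD v).
  have [|g [gwu _]] := fmin (w \oc u); first by rewrite compA fw.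
  apply: Xperp => F YF t.
  by rewrite -[t]pull_id -gwu compA pull_comp (XY0 XD YF (pull _ t)) pullm0.
split=> //; apply: Yperp => A XA t.
(* Wakamatsu: minimality splits the push-out of [t] along [k].               *)
have [|c ->] := triangle_push_exact tr (t := t); last exact: Xd.
have [Z [a [b trZ]]] := triangle_exists (push k t).
have XZ : X Z.
  by apply: Xperp => F YF; apply: (ext0_extension trZ); apply: XY0.
have [|f1 f1a] := triangle_extend trZ (a := f).
  by rewrite -push_comp (triangle_comp0 tr) push0m.
(* Minimality makes [w a] invertible, which splits [trZ] and gives [push k t = 0]. *)
have [w fw] := triangle_lift_defl tr (Xd Z XZ f1).
have [|g [gwa _]] := fmin (w \oc a); first by rewrite compA fw.
by apply: (triangle_split trZ (r := g \oc w)); rewrite -compA.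
Qed.

(** The part of a special precover that survives the passage to a right minimal one. *)
Definition special_cover M : Prop :=
  exists K B (k : hom K B) (f : hom B M) (d : Ext M K),
    [/\ triangle k f d, factoring X f
      & forall A, X A -> forall c : hom A M, pull c d = 0].

Lemma cotorsion_cover (hks : forall A, exists n, local_sum n A) M :
  special_cover M ->
  exists K B (k : hom K B) (f : hom B M) (d : Ext M K),
    [/\ X B, Y K & triangle k f d].
Proof.
move=> [K [B [k [f [d [tr Xf Xd]]]]]].
have [K' [B' [k' [f' [d' [tr' Xf' Xd' fmin]]]]]] :=
  right_minimal_triangle hks tr Xf Xd.
have [XB YK] := right_minimal_cover tr' Xf' Xd' fmin.
by exists K', B', k', f', d'.
Qed.

End HalfCotorsion.
End Triangles.

(** * The opposite extriangulated category *)

Definition op_cat (C : preAddCat) : preAddCat.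
Proof.
refine (@PreAddCat (obj C) (fun A B => hom B A) (fun A => idm A)
  (fun A B D g f => f \oc g) _ _ _ _ _).
- by move=> *; rewrite compm1.
- by move=> *; rewrite comp1m.
- by move=> *; rewrite compA.
- by move=> *; rewrite compDr.
- by move=> *; rewrite compDl.
(* Transparent, so that maps and their composites pass to the opposite category by conversion. *)
Defined.

Section Opposite.
Variable C : preAddCat.

Definition op_biprod (A B : C) (P : @biprod (op_cat C) A B) : biprod B A :=
  @Biprod C B A (bp P) (pr2 P) (pr1 P) (in2 P) (in1 P)
    (pr2_in2 P) (pr1_in1 P) (pr1_in2 P) (pr2_in1 P)
    (etrans (addrC _ _) (in_pr P)).

Lemma op_is_iso (A B : C) (f : hom A B) :
  is_iso f <-> @is_iso (op_cat C) B A f.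
Proof. by split=> -[g [gf fg]]; exists g. Qed.

(** The Krull-Schmidt property reaches the opposite category in this form; inclusions and
    projections trade places. *)
Lemma op_local_sum n (A : C) : local_sum n A -> @local_sum (op_cat C) n A.
Proof.
elim: n A / => [A A0|n A B D i1 i2 p1 p2 [e11 e22 e12 e21 es] locA _ IH].
  by apply: local_sum0 => B f g; case: (A0 B g f).
apply: (@local_sumS (op_cat C) n A B D p1 p2 i1 i2) => //.
case: locA => A0 locA; split=> // f g /op_is_iso /locA.
by case=> [/op_is_iso ?|/op_is_iso ?]; [left|right].
Qed.

Lemma op_additive : is_additive C -> is_additive (op_cat C).
Proof.
move=> [[Z Z0] hP]; split=> [|A B].
  by exists Z => B f g; case: (Z0 B g f).
case: (hP A B) => P; constructor.
exact: (@Biprod (op_cat C) A B (bp P) (pr1 P) (pr2 P) (in1 P) (in2 P)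
  (pr1_in1 P) (pr2_in2 P) (pr2_in1 P) (pr1_in2 P) (in_pr P)).
Qed.

Definition op_ext (E : addBifunctor C) : addBifunctor (op_cat C).
Proof.
refine (@AddBifunctor (op_cat C) (fun D A => ext E A D)
  (fun D A A' a => @pull C E D A A' a)
  (fun A D D' c => @push C E A D D' c) _ _ _ _ _ _ _ _ _).
- by move=> *; apply: pullD.
- by move=> *; apply: pushD.
- by move=> *; apply: pull_id.
- by move=> *; apply: push_id.
- by move=> *; apply: pull_comp.
- by move=> *; apply: push_comp.
- by move=> *; rewrite push_pull.
- by move=> *; apply: pull_addm.
- by move=> *; apply: push_addm.
Defined.

End Opposite.

Section OppositeExtri.
Variable T : extriCat.

Definition op_realizes : realization_rel (op_ext (EE T)) :=
  fun A B D x y d => @realizes T D B A y x d.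

Lemma op_seq_equiv (A D B B' : T) (x : hom A B) (y : hom B D) (x' : hom A B')
    (y' : hom B' D) :
  seq_equiv x y x' y' <-> @seq_equiv (op_cat T) D A B B' y x y' x'.
Proof.
split=> -[b [[g [gb bg]] h1 h2]]; rewrite /= in b g gb bg h1 h2;
  exists g; (split; first by exists b).
- by rewrite /= -h2 -compA bg compm1.
- by rewrite /= -h1 compA gb comp1m.
- by rewrite -h2 compA bg comp1m.
by rewrite -h1 -compA gb compm1.
Qed.

Lemma op_realizes_class : realizes_one_class op_realizes.
Proof.
split=> [A D d|A D d B B' x y x' y' r].
  by have [B [x [y r]]] := proj1 (realizes_class T) D A d; exists B, y, x.
split=> [r'|/op_seq_equiv e].
  by apply/op_seq_equiv; apply/(proj2 (realizes_class T) _ _ _ _ _ _ _ _ _ r).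
exact/(proj2 (realizes_class T) _ _ _ _ _ _ _ _ _ r).
Qed.

Lemma op_realizes_mor : realization_axiom op_realizes.
Proof.
move=> A B D x y d A' B' D' x' y' d' a c r r' e.
have [|b [_ h1 h2]] := @realizes_mor T _ _ _ _ _ _ _ _ _ _ _ _ c a r' r.
  by [].
by exists b.
Qed.

Lemma op_realizes_additive : additive_realization op_realizes.
Proof.
split=> [A D P|A B D x y d A' B' D' x' y' d' P Q R r r'].
  exact: (proj1 (realizes_additive T) D A (op_biprod P)).
(* Reversal swaps the two summands, so sums of maps and of classes agree up to commutativity. *)
have hE (A1 A2 B1 B2 : op_cat T) (P1 : biprod A1 A2) (P2 : biprod B1 B2) f1 f2 :
    hom_sum (op_biprod P2) (op_biprod P1) f2 f1 = hom_sum P1 P2 f1 f2.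
  by rewrite /hom_sum /= !compA addrC.
have := proj2 (realizes_additive T) _ _ _ _ _ _ _ _ _ _ _ _
  (op_biprod R) (op_biprod Q) (op_biprod P) r' r.
rewrite !hE /op_realizes; congr realizes.
by rewrite /ext_sum /= !push_pull addrC.
Qed.

Lemma op_et3 : ET3 op_realizes.
Proof.
move=> A B D x y d A' B' D' x' y' d' a b r r' e.
have [|c [h1 h2 h3]] := @et3op T _ _ _ _ _ _ _ _ _ _ _ _ b a r' r.
  by [].
by exists c.
Qed.

Lemma op_et3op : ET3op op_realizes.
Proof.
move=> A B D x y d A' B' D' x' y' d' b c r r' e.
have [|a [h1 h2 h3]] := @et3 T _ _ _ _ _ _ _ _ _ _ _ _ c b r' r.
  by [].
by exists a.
Qed.

Lemma op_et4 : ET4 op_realizes.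
Proof.
move=> A B D M F f f' d g g' d' r r'.
have [G [h' [u [v [d'' [h1 [h2 h3] h4 h5 h6]]]]]] :=
  @et4op T _ _ _ _ _ _ _ _ _ _ _ r' r.
by exists G, h', v, u, d''.
Qed.

Lemma op_et4op : ET4op op_realizes.
Proof.
move=> D A B F M f' f d g' g d' r r'.
have [G [h' [u [v [d'' [h1 [h2 h3] h4 h5 h6]]]]]] :=
  @et4 T _ _ _ _ _ _ _ _ _ _ _ r' r.
by exists G, h', v, u, d''.
Qed.

Definition op_extriCat : extriCat :=
  @ExtriCat (op_cat T) (op_additive (carrier_additive T)) (op_ext (EE T))
    op_realizes op_realizes_class op_realizes_mor op_realizes_additive
    op_et3 op_et3op op_et4 op_et4op.

End OppositeExtri.

(** * From the ideals back to the classes of objects *)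

Theorem theorem3p11 (C : extriCat) (hKS : krull_schmidt C) (X Y : subcat C)
    (hXi : iso_closed X) (hXs : summand_closed X)
    (hYi : iso_closed Y) (hYs : summand_closed Y) :
  complete_ideal_cotorsion_pair (factoring X) (factoring Y) ->
  complete_cotorsion_pair X Y.
Proof.
move=> [[_ _ perpX perpY] preX preY].
have hadd := carrier_additive C.
have hks := krull_schmidt_local_sum hadd hKS.
have fid (Z : subcat C) A : Z A -> factoring Z (idm A).
  by exists A, (idm A), (idm A); rewrite comp1m.
(* If [idm A] factors through [D], then [A] is a retract of [D], hence a summand. *)
have fidE (Z : subcat C) A : summand_closed Z -> factoring Z (idm A) -> Z A.
  move=> Zs [D [g [h [ZD gh]]]]; apply: Zs ZD.
  by apply: (retract_direct_summand hadd hks (s := h) (r := g)).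
have XY0 A B : X A -> Y B -> forall t : ext (EE C) A B, t = 0.
  move=> /fid /perpY XA /fid YB t.
  by have := XA _ _ _ YB t; rewrite /ext_map pull_id push_id.
have Xperp A : (forall B, Y B -> forall t : ext (EE C) A B, t = 0) -> X A.
  move=> A0; apply: fidE => //; apply/perpY => A' B' s [D [g [h [YD ->]]]] d.
  by rewrite /ext_map push_comp (A0 D YD (push h _)) pushm0.
have Yperp B : (forall A, X A -> forall t : ext (EE C) A B, t = 0) -> Y B.
  move=> B0; apply: fidE => //; apply/perpX => A' B' s [D [g [h [XD ->]]]] d.
  by rewrite /ext_map pull_comp push_pull (B0 D XD (push _ _)) pullm0.
split=> // M.
  apply: (cotorsion_cover XY0 Xperp Yperp hks).
  have [B [f [Xf [A [_ [_ [_ [l [K [k [h [_ [_ hp tr _]]]]]]]]]]]]] := preX M.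
  exists K, B, k, f, (push h l); split=> // A' XA' c.
  by rewrite -push_pull; apply: (hp _ _ c); exists A', c, (idm A');
    rewrite compm1.
have hksop (A : op_extriCat C) : exists n, local_sum n A.
  by have [n sA] := hks A; exists n; apply: op_local_sum.
(* The hypotheses on the two classes are self-dual, with [X] and [Y] exchanged; a preenvelope
   becomes a cover. *)
have [] := @cotorsion_cover (op_extriCat C) Y X _ _ _ hksop M.
- by move=> A B YA XB; apply: (XY0 B A).
- by move=> A A0; apply: Yperp.
- by move=> A A0; apply: Xperp.
- have [B [g [Yg [_ [A [_ [_ [d [D [p [h [_ [_ hp tr _]]]]]]]]]]]]] := preY M.
  exists D, B, p, g, (pull h d); split=> //.
    by case: Yg => D' [u [v [YD ->]]]; exists D', v, u.
  move=> A' YA' c; apply: (hp _ _ c).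
  by exists A', (idm A'), c; rewrite comp1m.
move=> K [B [k [f [d [YB XK tr]]]]].
by exists B, K, f, k, d.
Qed.
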